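(* For $k\ge0$, $$W_{112\text{-}1}(x;k)=1+\sum_{j=0}^{k-1}\left(\sum_{i=j}^{k-1}\binom{i}{j}(1-x^2)^{i-j}\right)x^{2j+1}W_{112\text{-}1}(x;k-j).$$
   Context: For $k\ge1$ let $[k]=\{1,\dots,k\}$; a $k$-ary word of length $n$ is an element of $[k]^n$ ($[0]^n$ is empty for $n\ge1$, and the empty word is the unique word of length $0$). Two words are order-isomorphic if replacing the $i$-th smallest distinct letter by $i$ yields the same word. A word $w=w_1\cdots w_n$ contains the vincular pattern $112\text{-}1$ if there are indices $p$ and $q\ge p+3$ with $w_pw_{p+1}w_{p+2}w_q$ order-isomorphic to $1121$; otherwise it avoids it. $a_{112\text{-}1}(n,k)$ is the number of words in $[k]^n$ avoiding it, and $W_{112\text{-}1}(x;k)=\sum_{n\ge0}a_{112\text{-}1}(n,k)x^n$. An empty sum equals $0$. *)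

(* Defs.v *)
From HB Require Import structures.
From mathcomp Require Import all_boot all_order all_algebra.
From mathcomp Require Import boolp.

Set Implicit Arguments.
Unset Strict Implicit.
Unset Printing Implicit Defensive.

Import GRing.Theory.

Local Open Scope ring_scope.

(* The ring R[[x]] of formal power series.  It is a record rather than the bare
   function type nat -> R, so that its product is the Cauchy product and not a
   pointwise one. *)
Record fps (R : comNzRingType) := Fps { fps_coef : nat -> R }.

Lemma fpsP (R : comNzRingType) (f g : fps R) :
  fps_coef f =1 fps_coef g <-> f = g.
Proof.
split=> [|-> //]; case: f g => [f] [g] /= efg.
by congr Fps; apply/funext.
Qed.

HB.instance Definition _ (R : comNzRingType) := gen_eqMixin (fps R).
HB.instance Definition _ (R : comNzRingType) := gen_choiceMixin (fps R).

Definition fps_zero (R : comNzRingType) : fps R := Fps (fun=> 0).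
Definition fps_add (R : comNzRingType) (f g : fps R) : fps R :=
  Fps (fun n => fps_coef f n + fps_coef g n).
Definition fps_opp (R : comNzRingType) (f : fps R) : fps R :=
  Fps (fun n => - fps_coef f n).
Definition fps_one (R : comNzRingType) : fps R := Fps (fun n => (n == 0%N)%:R).
Definition fps_mul (R : comNzRingType) (f g : fps R) : fps R :=
  Fps (fun n => \sum_(i < n.+1) fps_coef f i * fps_coef g (n - i)%N).

Lemma fps_addA (R : comNzRingType) : associative (@fps_add R).
Proof. by move=> f g h; apply/fpsP => n /=; rewrite addrA. Qed.

Lemma fps_addC (R : comNzRingType) : commutative (@fps_add R).
Proof. by move=> f g; apply/fpsP => n /=; rewrite addrC. Qed.

Lemma fps_add0 (R : comNzRingType) : left_id (fps_zero R) (@fps_add R).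
Proof. by move=> f; apply/fpsP => n /=; rewrite add0r. Qed.

Lemma fps_addN (R : comNzRingType) :
  left_inverse (fps_zero R) (@fps_opp R) (@fps_add R).
Proof. by move=> f; apply/fpsP => n /=; rewrite addNr. Qed.

HB.instance Definition _ (R : comNzRingType) :=
  GRing.isZmodule.Build (fps R)
    (@fps_addA R) (@fps_addC R) (@fps_add0 R) (@fps_addN R).

Definition fps_trunc (R : comNzRingType) (m : nat) (f : fps R) : {poly R} :=
  \poly_(i < m) fps_coef f i.

Lemma coef_fps_mul_trunc (R : comNzRingType) (m n : nat) (f g : fps R) :
  (n < m)%N -> fps_coef (fps_mul f g) n = (fps_trunc m f * fps_trunc m g)`_n.
Proof.
move=> ltnm; rewrite coefM; apply: eq_bigr => i _; rewrite !coef_poly.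
by rewrite (leq_ltn_trans (leq_ord i) ltnm) (leq_ltn_trans (leq_subr i n) ltnm).
Qed.

Lemma fps_mulA (R : comNzRingType) : associative (@fps_mul R).
Proof.
move=> f g h; apply/fpsP => n.
have tr (u v : fps R) (i : 'I_n.+1) :
    fps_coef (fps_mul u v) i = (fps_trunc n.+1 u * fps_trunc n.+1 v)`_i.
  exact: coef_fps_mul_trunc (ltn_ord i).
transitivity ((fps_trunc n.+1 f * (fps_trunc n.+1 g * fps_trunc n.+1 h))`_n).
  rewrite coefM; apply: eq_bigr => i _; rewrite [in RHS]coef_poly ltn_ord.
  by rewrite -(@coef_fps_mul_trunc R n.+1) // ltnS leq_subr.
rewrite mulrA coefM; apply: eq_bigr => i _.
by rewrite [X in _ * X = _]coef_poly ltnS leq_subr tr.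
Qed.

Lemma fps_mulC (R : comNzRingType) : commutative (@fps_mul R).
Proof.
by move=> f g; apply/fpsP => n; rewrite !(@coef_fps_mul_trunc _ n.+1) // mulrC.
Qed.

Lemma fps_mul1 (R : comNzRingType) : left_id (fps_one R) (@fps_mul R).
Proof.
move=> f; apply/fpsP => n /=; rewrite big_ord_recl /= mul1r subn0.
by rewrite big1 ?addr0 // => i _; rewrite mul0r.
Qed.

Lemma fps_mulDl (R : comNzRingType) :
  left_distributive (@fps_mul R) (@fps_add R).
Proof.
move=> f g h; apply/fpsP => n /=; rewrite -big_split /=.
by apply: eq_bigr => i _; rewrite mulrDl.
Qed.

Lemma fps_one_neq0 (R : comNzRingType) : fps_one R != 0.
Proof.
apply/eqP => /(congr1 (fun f => fps_coef f 0%N)) /= /eqP.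
by rewrite oner_eq0.
Qed.

HB.instance Definition _ (R : comNzRingType) :=
  GRing.Zmodule_isComNzRing.Build (fps R)
    (@fps_mulA R) (@fps_mulC R) (@fps_mul1 R) (@fps_mulDl R) (@fps_one_neq0 R).

Definition fpsX (R : comNzRingType) : fps R := Fps (fun n => (n == 1%N)%:R).

(* Replaces the i-th smallest distinct letter of w by i, counting from 1. *)
Definition word_reduce (w : seq nat) : seq nat :=
  [seq (index x (sort leq (undup w))).+1 | x <- w].

Definition order_isomorphic (u v : seq nat) : bool :=
  word_reduce u == word_reduce v.

Definition contains_112_1 (w : seq nat) : bool :=
  [exists p : 'I_(size w), exists q : 'I_(size w), (p + 3 <= q)%N &&
     order_isomorphic
       [:: nth 0%N w p; nth 0%N w p.+1; nth 0%N w p.+2; nth 0%N w q]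
       [:: 1; 1; 2; 1]%N].

(* A word of [k]^n, whose letters are 1, ..., k, is encoded by an n-tuple over
   'I_k = {0, ..., k-1}. *)
Definition letters (k n : nat) (w : n.-tuple 'I_k) : seq nat :=
  [seq (val x).+1 | x <- w].

Definition a_112_1 (n k : nat) : nat :=
  #|[set w : n.-tuple 'I_k | ~~ contains_112_1 (letters w)]|.

Definition W_112_1 (k : nat) : fps int := Fps (fun n => (a_112_1 n k)%:R).

(* Main.v *)
(** A word [b w'] is counted by the words [w'], except that one must discard
    those of the form [w' = b c u] with [c > b] and [b] in [u].  Since [b c] creates
    no occurrence, these are [x^2] times the avoiding words starting with [c]
    which contain [b].  Hence, if [V k b] is the generating function of the
    avoiding words over [k] letters starting with [b],
      [V k b = x W k - x^2 \sum_(c > b) (V k c - V (k-1) (c-1))].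
    Subtracting this equation at [b+1] from the one at [b] gives
      [V k b = (1 - x^2) V k (b+1) + x^2 V (k-1) b],
    a binomial recurrence in the number [i] of letters greater than [b]; its
    solution, summed over [i], is the theorem. *)
Require Import Defs.
From mathcomp Require Import all_boot all_order all_algebra.
From mathcomp Require Import ring zify.

Set Implicit Arguments.
Unset Strict Implicit.
Unset Printing Implicit Defensive.

Import GRing.Theory.
Local Open Scope ring_scope.

(** * Occurrences of the pattern *)

Definition starts_112_1 (w : seq nat) : bool :=
  if w is [:: a, b, c & u] then [&& a == b, (b < c)%N & a \in u] else false.

(** Recursive form of containment, in which prepending a letter adds only the occurrences that begin
    at that letter. *)
Fixpoint has_112_1 (w : seq nat) : bool :=
  if w is a :: w' then starts_112_1 w || has_112_1 w' else false.

Lemma order_isomorphic_1121 (a b c d : nat) :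
  order_isomorphic [:: a; b; c; d] [:: 1; 1; 2; 1]%N =
  [&& a == b, (b < c)%N & a == d].
Proof.
rewrite /order_isomorphic.
have -> : word_reduce [:: 1; 1; 2; 1]%N = [:: 1; 1; 2; 1]%N by [].
apply/eqP/and3P => [|[/eqP <- ltac /eqP <-]]; last first.
  have nea : (a == c) = false by apply: ltn_eqF.
  rewrite /word_reduce /= !inE eqxx (eq_sym c) nea /= /sort /=.
  have -> : (c <= a)%N = false by lia.
  by rewrite /= !eqxx nea.
set w := [:: a; b; c; d]; rewrite /word_reduce; set s := sort leq (undup w).
have ins x : x \in w -> x \in s by rewrite mem_sort mem_undup.
have ina : a \in s by apply: ins; rewrite !inE eqxx.
have inb : b \in s by apply: ins; rewrite !inE eqxx ?orbT.
have inc : c \in s by apply: ins; rewrite !inE eqxx ?orbT.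
have ind : d \in s by apply: ins; rewrite !inE eqxx ?orbT.
case=> ia ib ic id.
have eab : a = b by rewrite -(nth_index 0%N ina) ia -ib nth_index.
have ead : a = d by rewrite -(nth_index 0%N ina) ia -id nth_index.
rewrite -eab -ead !eqxx; split=> //.
(* The reduced letters put [a] and [c] at positions 0 and 1 of the sorted list [s]; this gives
   [a <= c], and distinct positions exclude equality. *)
have le_ac : (a <= c)%N.
  rewrite -(nth_index 0%N ina) -(nth_index 0%N inc) ia ic.
  have ss : sorted leq s by apply: sort_sorted; apply: leq_total.
  have s1 : (1 < size s)%N by rewrite -ic index_mem.
  by apply: (sorted_leq_nth leq_trans leqnn) => //; rewrite inE ?(ltnW s1).
rewrite ltn_neqAle le_ac andbT; apply/eqP => eac.
by move: ic; rewrite -eac ia.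
Qed.

Lemma has_112_1P (w : seq nat) :
  reflect (exists p q, [/\ (p + 3 <= q)%N, (q < size w)%N,
             nth 0%N w p = nth 0%N w p.+1, (nth 0%N w p.+1 < nth 0%N w p.+2)%N
             & nth 0%N w p = nth 0%N w q])
          (has_112_1 w).
Proof.
elim: w => [|a w IH] /=; first by constructor; case=> p [q []].
apply: (iffP orP) => [[]|].
- case: w {IH} => [|b [|c u]] //= /and3P[/eqP eab ltbc au].
  exists 0%N, (3 + index a u)%N; split=> //=; last by rewrite nth_index.
  by rewrite !ltnS index_mem.
- by case/IH => p [q [lepq ltq e1 e2 e3]]; exists p.+1, q.+1; split.
case=> -[|p] [[|q] [lepq ltq e1 e2 e3]] //; last first.
  by right; apply/IH; exists p, q; split.
left; case: w {IH} ltq e1 e2 e3 => [|b [|c u]] //=.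
move: q lepq => [|[|q]] //= _; rewrite !ltnS => ltq <- -> ->.
by rewrite eqxx mem_nth.
Qed.

Lemma contains_112_1E (w : seq nat) : contains_112_1 w = has_112_1 w.
Proof.
apply/existsP/has_112_1P => [[p /existsP[q /andP[lepq]]]|[p [q [lepq ltq e1 e2 e3]]]].
  rewrite order_isomorphic_1121 => /and3P[/eqP e1 e2 /eqP e3].
  by exists p, q; split.
have ltp : (p < size w)%N by lia.
exists (Ordinal ltp); apply/existsP; exists (Ordinal ltq) => /=.
by rewrite lepq order_isomorphic_1121 e1 e2 -e3 e1 eqxx.
Qed.

(** Serves twice: for [S], which passes to letters counted from 1, and for [bump b], which skips a
    letter of the alphabet. *)
Lemma has_112_1_map (f : nat -> nat) (w : seq nat) :
  {mono f : x y / (x <= y)%N} -> has_112_1 (map f w) = has_112_1 w.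
Proof.
move=> fm; have fi : injective f.
  by move=> x y e; apply/eqP; rewrite eqn_leq -(fm x) -(fm y) e leqnn.
have fl x y : (f x < f y)%N = (x < y)%N by rewrite !ltnNge fm.
elim: w => //= a w ->; congr (_ || _).
by case: w => [|b [|c u]] //=; rewrite (inj_eq fi) fl mem_map.
Qed.

(** * Counting words *)

Definition word_count (k n : nat) (P : pred (seq nat)) : nat :=
  \sum_(w : n.-tuple 'I_k) P (map val w).

Lemma eq_word_count (k n : nat) (P Q : pred (seq nat)) :
  P =1 Q -> word_count k n P = word_count k n Q.
Proof. by move=> e; apply: eq_bigr => w _; rewrite e. Qed.

Lemma word_count_pred0 (k n : nat) (P : pred (seq nat)) :
  P =1 pred0 -> word_count k n P = 0%N.
Proof. by move=> e; apply: big1 => w _; rewrite e. Qed.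

Lemma word_countID (k n : nat) (Q P : pred (seq nat)) :
  word_count k n P =
  (word_count k n (predI Q P) + word_count k n (predI (predC Q) P))%N.
Proof. by rewrite -big_split; apply: eq_bigr => w _ /=; case: (Q _); case: (P _). Qed.

Lemma word_count0 (k : nat) (P : pred (seq nat)) : word_count k 0 P = P [::].
Proof.
rewrite /word_count (big_pred1 [tuple]) // => w.
by rewrite [w]tuple0; apply/esym/eqP/val_inj.
Qed.

Lemma word_countS (k n : nat) (P : pred (seq nat)) :
  word_count k n.+1 P = (\sum_(a < k) word_count k n (fun w => P (val a :: w)))%N.
Proof.
rewrite /word_count pair_bigA /=.
rewrite (reindex (fun p : 'I_k * n.-tuple 'I_k => [tuple of p.1 :: p.2])) //=.
exists (fun w : n.+1.-tuple 'I_k => (thead w, [tuple of behead w])).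
  by case=> a w _ /=; rewrite theadE; congr (_, _); apply: val_inj.
by move=> w _; rewrite /= -tuple_eta.
Qed.

(** [bump b] is an increasing bijection from the [k] smallest naturals to the [k.+1] smallest ones
    without [b]. *)
Lemma word_count_notin (k n b : nat) (P : pred (seq nat)) : (b <= k)%N ->
  word_count k.+1 n (fun w => (b \notin w) && P w) =
  word_count k n (fun w => P (map (bump b) w)).
Proof.
rewrite -ltnS => ltb; elim: n P => [|n IH] P; first by rewrite !word_count0.
rewrite !word_countS (bigD1_ord (Ordinal ltb)) //= word_count_pred0 ?add0n.
  apply: eq_bigr => a _; rewrite -(IH (fun w => P (bump b a :: w))).
  by apply: eq_word_count => w; rewrite /= inE negb_or neq_bump.
by move=> w; rewrite /= inE eqxx.
Qed.

Lemma a_112_1E (n k : nat) : a_112_1 n k = word_count k n (predC has_112_1).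
Proof.
rewrite /a_112_1 -sum1dep_card big_mkcond /=; apply: eq_bigr => w _ /=.
rewrite contains_112_1E /letters (map_comp S val).
by rewrite (@has_112_1_map S) //; case: has_112_1.
Qed.

Definition first_count (k b n : nat) : nat :=
  if n is n'.+1 then word_count k n' (fun w => ~~ has_112_1 (b :: w)) else 0%N.

Lemma a_112_1S (n k : nat) :
  a_112_1 n.+1 k = (\sum_(b < k) first_count k b n.+1)%N.
Proof. by rewrite a_112_1E word_countS. Qed.

(** Avoiding words [c :: u] are split by whether [b] is in [u]; if not, removing [b] from the
    alphabet lowers [c] to [c.-1]. *)
Lemma word_count_in_first (k n b c : nat) : (b < c <= k)%N ->
  (word_count k.+1 n (fun u => (b \in u) && ~~ has_112_1 (c :: u))
   + first_count k c.-1 n.+1)%N = first_count k.+1 c n.+1.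
Proof.
case/andP=> ltbc lec; rewrite /first_count.
rewrite [RHS](word_countID _ _ (fun u => b \in u)); congr (_ + _)%N.
rewrite [RHS](word_count_notin n (fun w => ~~ has_112_1 (c :: w))); last by lia.
apply: eq_word_count => w; congr negb.
rewrite -[LHS](@has_112_1_map (bump b)) /=.
  by have -> : bump b c.-1 = c by rewrite /bump; lia.
by move=> x y; rewrite leq_bump2.
Qed.

(** The discarded words are [b b c u] with [b < c] and [b] in [u]; stripping [b b] leaves length
    [n.+1]. Terms are moved across so that no subtraction of naturals occurs. *)
Lemma first_count_rec (k b n : nat) : (b <= k)%N ->
  (first_count k.+1 b n.+3 + \sum_(b.+1 <= c < k.+1) first_count k.+1 c n.+1)%N =
  (a_112_1 n.+2 k.+1 + \sum_(b.+1 <= c < k.+1) first_count k c.-1 n.+1)%N.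
Proof.
move=> leb; rewrite a_112_1E.
rewrite [in RHS](word_countID _ _ (fun w => ~~ starts_112_1 (b :: w))).
rewrite -addnA; congr (_ + _)%N.
  by apply: eq_word_count => w; rewrite /= negb_or.
have ltb : (b < k.+1)%N by [].
(* An occurrence starting at the prepended [b] forces the next letter to be [b] too. *)
rewrite word_countS (bigD1_ord (Ordinal ltb)) //= [X in (_ + X + _)%N]big1 ?addn0; last first.
  move=> a _; apply: word_count_pred0 => -[|c w] //=.
  by rewrite (negbTE (neq_bump _ _)).
transitivity (\sum_(b.+1 <= c < k.+1)
    (word_count k.+1 n (fun u => (b \in u) && ~~ has_112_1 (c :: u))
     + first_count k c.-1 n.+1))%N.
  by rewrite !big_nat; apply: eq_bigr => c /andP[*]; rewrite word_count_in_first //; lia.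
rewrite big_split /=; congr (_ + _)%N.
pose G c := word_count k.+1 n (fun u => (b \in u) && ~~ has_112_1 (c :: u)).
(* Padding with zeros makes [c] range over all letters, as the letter after [b b] does. *)
transitivity (\sum_(0 <= c < k.+1) if (b < c)%N then G c else 0)%N.
  rewrite [RHS](big_cat_nat (n := b.+1)) //= [X in (X + _)%N]big1_seq ?add0n.
    by apply: eq_big_nat => c /andP[-> _].
  move=> c /=; rewrite mem_index_iota => /andP[_]; rewrite ltnS => lec.
  by rewrite ltnNge lec.
rewrite word_countS big_mkord; apply: eq_bigr => c _; case: ltnP => bc.
  apply: eq_word_count => w /=; rewrite eqxx /= negbK; case: (b \in w) => //=.
  (* No occurrence begins at the [b] just before [c], since [b] differs from [c]. *)
  by case: w => [|d w] //=; rewrite (ltn_eqF bc).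
by rewrite word_count_pred0 // => w /=; rewrite andbF.
Qed.

(** * Generating functions *)

Lemma coef_fpsXM (R : comNzRingType) (f : fps R) (n : nat) :
  fps_coef (fpsX R * f) n = if n is m.+1 then fps_coef f m else 0.
Proof.
change (fps_coef (fps_mul (fpsX R) f) n = if n is m.+1 then fps_coef f m else 0).
case: n => [|n] /=; first by rewrite big_ord1 mul0r.
rewrite big_ord_recl mul0r add0r big_ord_recl mul1r /= subSS subn0.
by rewrite big1 ?addr0 // => i _; rewrite mul0r.
Qed.

Lemma coef_fpsD (R : comNzRingType) (f g : fps R) (n : nat) :
  fps_coef (f + g) n = fps_coef f n + fps_coef g n.
Proof. by []. Qed.

Lemma coef_fps_sum (R : comNzRingType) (I : Type) (r : seq I) (P : pred I)
    (F : I -> fps R) (n : nat) :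
  fps_coef (\sum_(i <- r | P i) F i) n = \sum_(i <- r | P i) fps_coef (F i) n.
Proof. exact: (big_morph (fun f : fps R => fps_coef f n)). Qed.

Definition V_112_1 (k b : nat) : fps int := Fps (fun n => (first_count k b n)%:R).

Lemma W_112_1_first (k : nat) : W_112_1 k = 1 + \sum_(0 <= b < k) V_112_1 k b.
Proof.
rewrite big_mkord; apply/fpsP => -[|n]; rewrite coef_fpsD coef_fps_sum /=.
  by rewrite a_112_1E word_count0 big1.
by rewrite a_112_1S add0r natr_sum.
Qed.

Lemma V_112_1_sum (k b : nat) : (b <= k)%N ->
  V_112_1 k.+1 b + fpsX int ^+ 2 * (\sum_(b.+1 <= c < k.+1) V_112_1 k.+1 c) =
  fpsX int * W_112_1 k.+1 + fpsX int ^+ 2 * (\sum_(b.+1 <= c < k.+1) V_112_1 k c.-1).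
Proof.
move=> leb; apply/fpsP => n.
rewrite expr2 -!mulrA !coef_fpsD !coef_fpsXM.
(* Degrees below 3 are checked by hand: words that short avoid the pattern, and [first_count]
   vanishes at length 0. *)
case: n => [|[|n]]; rewrite ?coef_fpsXM ?coef_fps_sum /= ?addr0 //.
  by rewrite a_112_1E !word_count0.
case: n => [|n].
  rewrite !big1 // !addr0 a_112_1E; congr (_%:R).
  rewrite !word_countS; apply: eq_bigr => a _.
  by rewrite !word_count0.
by rewrite -!natr_sum -!natrD first_count_rec.
Qed.

Lemma V_112_1_last (k : nat) : V_112_1 k.+1 k = fpsX int * W_112_1 k.+1.
Proof. by have := V_112_1_sum (leqnn k); rewrite !big_geq // mulr0 !addr0. Qed.

Lemma V_112_1_rec (k b : nat) : (b < k)%N ->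
  V_112_1 k.+1 b =
  (1 - fpsX int ^+ 2) * V_112_1 k.+1 b.+1 + fpsX int ^+ 2 * V_112_1 k b.
Proof.
move=> ltb; have e1 := V_112_1_sum ltb; have e2 := V_112_1_sum (ltnW ltb).
(* The term [c = b.+1] is split off; on the right it is [V_112_1 k b]. *)
rewrite big_ltn // [\sum_(_ <= c < _) V_112_1 k _]big_ltn //= in e2.
set S := \sum_(_ <= c < _) V_112_1 k.+1 _ in e1 e2.
set T := \sum_(_ <= c < _) V_112_1 k _ in e1 e2.
apply: (addIr (fpsX int ^+ 2 * (V_112_1 k.+1 b.+1 + S))); rewrite e2.
by rewrite !mulrDr addrCA -e1; ring.
Qed.

Definition binomial_term (k i j : nat) : fps int :=
  'C(i, j)%:R * (1 - fpsX int ^+ 2) ^+ (i - j)%N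
  * fpsX int ^+ (2 * j + 1)%N * W_112_1 (k - j)%N.

Lemma binomial_term_small (k i j : nat) : (i < j)%N -> binomial_term k i j = 0.
Proof. by move=> ltij; rewrite /binomial_term bin_small // !mul0r. Qed.

Lemma binomial_term0 (k i : nat) :
  binomial_term k i.+1 0 = (1 - fpsX int ^+ 2) * binomial_term k i 0.
Proof. by rewrite /binomial_term !bin0 !subn0 exprS; ring. Qed.

(** Pascal's rule, matched to the shape of [V_112_1_rec]. *)
Lemma binomial_termS (k i j : nat) :
  binomial_term k.+1 i.+1 j.+1 =
  (1 - fpsX int ^+ 2) * binomial_term k.+1 i j.+1
  + fpsX int ^+ 2 * binomial_term k i j.
Proof.
rewrite /binomial_term binS natrD !subSS.
have -> : (2 * j.+1 + 1 = 2 + (2 * j + 1))%N by lia.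
(* When [i <= j] the truncated exponent [i - j.+1] is harmless, because ['C(i, j.+1)] is zero. *)
rewrite exprD; case: (ltnP j i) => [ltji|leij].
  have -> : (i - j = (i - j.+1).+1)%N by lia.
  by rewrite exprS; ring.
by rewrite (bin_small (n := i)) //; ring.
Qed.

(** Here [i] counts the letters above [b]. Both terms on the right of [V_112_1_rec] have one such
    letter fewer, hence the induction on [i] for all [b]. *)
Lemma V_112_1E (i b : nat) :
  V_112_1 (b + i.+1) b = \sum_(0 <= j < i.+1) binomial_term (b + i.+1) i j.
Proof.
elim: i b => [|i IH] b.
  rewrite addn1 V_112_1_last big_nat1 /binomial_term bin0 subn0 expr0 !mul1r.
  by rewrite expr1 subn0.
rewrite addnS V_112_1_rec; last by lia.
have eb : (b + i.+1).+1 = (b.+1 + i.+1)%N by lia.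
rewrite [in V_112_1 _.+1 _]eb !IH -eb.
rewrite [in RHS]big_nat_recl // (eq_bigr _ (fun j _ => binomial_termS _ _ _)).
rewrite big_split /= -!mulr_sumr addrA binomial_term0 -mulrDr.
(* The term [j = 0] rejoins the shifted sum, whose last term [j = i.+1] vanishes. *)
rewrite -(big_nat_recl i.+1 0 (binomial_term (b + i.+1).+1 i)) //.
by rewrite [in RHS]big_nat_recr //= binomial_term_small // addr0.
Qed.

Theorem theorem4p3 (k : nat) :
  W_112_1 k =
  1 + \sum_(0 <= j < k)
        (\sum_(j <= i < k) 'C(i, j)%:R * (1 - fpsX int ^+ 2) ^+ (i - j)%N)
        * fpsX int ^+ (2 * j + 1)%N * W_112_1 (k - j)%N.
Proof.
(* Reversal indexes the first letter by the number [i] of letters above it. *)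
rewrite {1}W_112_1_first big_nat_rev /=; congr (_ + _).
(* Zero terms with [i < j] fill the triangle to a square, so that the sums can be exchanged. *)
transitivity (\sum_(0 <= i < k) \sum_(0 <= j < k) binomial_term k i j).
  apply: eq_big_nat => i /andP[_ ltik].
  have ek : k = (0 + k - i.+1 + i.+1)%N by lia.
  rewrite [in V_112_1 k]ek V_112_1E -ek [RHS](big_cat_nat (n := i.+1)) //=.
  rewrite [X in _ = _ + X]big1_seq ?addr0 // => j /=.
  by rewrite mem_index_iota => /andP[ltij _]; exact: binomial_term_small.
rewrite exchange_big_nat /=; apply: eq_big_nat => j /andP[_ ltjk].
rewrite (big_cat_nat (n := j)) ?(ltnW ltjk) //= big1_seq ?add0r; last first.
  by move=> i; rewrite mem_index_iota => /andP[_]; exact: binomial_term_small.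
by rewrite !mulr_suml.
Qed.
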